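(* Let $n\ge 1$. Among all $n$-dimensional centred Gaussian random vectors $X=(X_1,\dots,X_n)$ satisfying $\operatorname{tr}\operatorname{Cov}X=1$, the quantity $\mathbb{E}\,\|X\|_\infty$ is maximal when $\operatorname{Cov}X$ is diagonal with at most two non-zero entries, and it is minimal when the absolute values of the coordinates of $X$ are identical almost everywhere, i.e. $|X_i|=|X_j|$ almost surely for all $1\le i,j\le n$.
   Context: A random vector is called centred if the mean values of its coordinates are all $0$. Gaussian random vectors may be degenerate (the covariance matrix is allowed to be singular). $\operatorname{Cov}X$ denotes the $n\times n$ covariance matrix of $X$ and $\operatorname{tr}$ the trace. For $x\in\mathbb{R}^n$, $\|x\|_\infty=\max_{1\le i\le n}|x_i|$. *)

(* Defs.v *)
From HB Require Import structures.
From mathcomp Require Import all_boot all_order all_algebra.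
From mathcomp Require Import all_classical all_reals all_analysis.

Set Implicit Arguments.
Unset Strict Implicit.
Unset Printing Implicit Defensive.

Import Order.TTheory GRing.Theory Num.Theory.
Import numFieldNormedType.Exports.

Local Open Scope classical_set_scope.
Local Open Scope ring_scope.

(* Univariate Gaussian law, point masses included. They need a separate clause:
   [normal_prob m 0] is the uniform law on [0, 1], not the point mass at [m].
   Laws are compared on measurable sets only, since [dirac] and [normal_prob]
   take unrelated junk values elsewhere. *)
Definition gaussian_law (R : realType) (mu : set R -> \bar R) : Prop :=
  (exists m : R, forall A : set R, measurable A -> mu A = dirac m A) \/
  (exists m s : R, 0 < s /\
     forall A : set R, measurable A -> mu A = normal_prob m s A).

Section random_vector.
Context (R : realType) (n : nat).
Context (d : measure_display) (T : measurableType d) (P : probability T R).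
Implicit Type X : 'I_n -> {RV P >-> R}.

(* Gaussian vector, possibly degenerate: every linear combination of the
   coordinates is (possibly degenerate) univariate Gaussian. *)
Definition gaussian_vector X : Prop :=
  forall a : 'I_n -> R,
    gaussian_law (pushforward P (fun t => \sum_(i < n) a i * X i t)).

Definition centred X : Prop := forall i, 'E_P[X i]%E = 0%E.

(* [fine] loses nothing on Gaussian vectors: their covariances are finite. *)
Definition cov_mx X : 'M[R]_n :=
  \matrix_(i < n, j < n) fine (covariance P (X i) (X j)).

Definition sup_norm X (t : T) : R := \big[Num.max/0]_(i < n) `|X i t|.

Definition normalized_gaussian X : Prop :=
  [/\ gaussian_vector X, centred X & \tr (cov_mx X) = 1].

End random_vector.

(* The competitors live on arbitrary probability spaces, not only on that of
   [X]. *)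
Definition maximizes_mean_sup_norm (R : realType) (n : nat)
    (d : measure_display) (T : measurableType d) (P : probability T R)
    (X : 'I_n -> {RV P >-> R}) : Prop :=
  forall (d' : measure_display) (T' : measurableType d')
    (P' : probability T' R) (Y : 'I_n -> {RV P' >-> R}),
    normalized_gaussian Y -> ('E_P'[sup_norm Y] <= 'E_P[sup_norm X])%E.

Definition minimizes_mean_sup_norm (R : realType) (n : nat)
    (d : measure_display) (T : measurableType d) (P : probability T R)
    (X : 'I_n -> {RV P >-> R}) : Prop :=
  forall (d' : measure_display) (T' : measurableType d')
    (P' : probability T' R) (Y : 'I_n -> {RV P' >-> R}),
    normalized_gaussian Y -> ('E_P[sup_norm X] <= 'E_P'[sup_norm Y])%E.

(* Main.v *)
(* Everything reduces to one-dimensional laws. A centred Gaussian Y satisfies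
   E|Y| = kappa * sqrt (Var Y), where kappa = E|g| / sqrt (E g^2) for a standard
   normal g.

   Upper bound: averaging over independent random signs e gives
   max_i |x_i| <= E_e |sum_i e_i x_i|, by pairing e with its flip at all indices
   but i. Hence E max_i |X_i| <= kappa * E_e sqrt (Var (sum_i e_i X_i)), and, as
   sqrt v <= (v + 1) / 2 and E_e Var (sum_i e_i X_i) = tr Cov X = 1, this is at
   most kappa. The value kappa is attained by two uncorrelated coordinates,
   because 2 max(|x|, |y|) = |x + y| + |x - y|.

   Lower bound: E max_i |X_i| >= E|X_j| = kappa * sqrt (Var X_j) and some
   Var X_j is at least 1 / n; if all |X_i| coincide, every variance is 1 / n and
   the maximum is |X_j|. *)
Require Import Defs.
From HB Require Import structures.
From mathcomp Require Import all_boot all_order all_algebra.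
From mathcomp Require Import all_classical all_reals all_analysis.
From mathcomp Require Import measurable_realfun ring lra.

Set Implicit Arguments.
Unset Strict Implicit.
Unset Printing Implicit Defensive.

Import Order.TTheory GRing.Theory Num.Theory.
Import numFieldNormedType.Exports.

Local Open Scope classical_set_scope.
Local Open Scope ring_scope.

(** * Integrals against normal laws: change of variables, symmetry, moments *)

Section normal_integral.
Context (R : realType).
Implicit Types (m s : R) (G : R -> R).
Local Notation mu := (@lebesgue_measure R).
Local Notation N01 := (@normal_prob R 0 1).

(** The Radon-Nikodym derivative of [normal_prob m s] and its density have the same integral over
    every measurable set, so they agree almost everywhere and may be exchanged under the
    integral. *)
Lemma ge0_integral_normal_prob m s (f : R -> \bar R) :
  measurable_fun [set: R] f -> (forall x, 0 <= f x)%E ->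
  (\int[normal_prob m s]_x f x =
   \int[mu]_x (f x * (normal_pdf m s x)%:E))%E.
Proof.
move=> mf f0.
have dom := @normal_prob_dominates R m s.
rewrite -(Radon_Nikodym_SigmaFinite.change_of_variables dom)//.
have mpdf : measurable_fun [set: R]
    (fun x : measurableTypeR R => (normal_pdf m s x)%:E).
  by apply/measurable_EFinP; exact: measurable_normal_pdf.
have intf := Radon_Nikodym_SigmaFinite.f_integrable dom.
apply: ae_eq_integral => //.
- apply: emeasurable_funM => //; exact: (measurable_int mu).
- exact: emeasurable_funM.
- apply: ae_eqe_mul2l; apply: integral_ae_eq => // E _ mE.
  by rewrite -Radon_Nikodym_SigmaFinite.f_integral.
Qed.

Lemma normal_prob_affine m s G : 0 < s -> continuous G ->
  (forall x, 0 <= G x) ->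
  (\int[normal_prob m s]_x (G x)%:E = \int[N01]_x (G (m + s * x))%:E)%E.
Proof.
move=> s0 cG G0.
have cl : continuous (fun x : R => m + s * x).
  move=> x; apply: (@cvgD _ R^o); first exact: cvg_cst.
  by apply: cvgM; [exact: cvg_cst|exact: cvg_id].
have cGl : continuous (fun x : R => G (m + s * x)).
  by move=> x; apply: (cvg_comp _ G); [exact: cl|exact: cG].
rewrite !ge0_integral_normal_prob//; first last.
- by apply: measurableT_comp => //; exact: continuous_measurable_fun cG.
- by move=> x; rewrite lee_fin.
- by apply: measurableT_comp => //; exact: continuous_measurable_fun cGl.
have s_neq0 : s != 0 by rewrite gt_eqF.
pose F (x : R) : R := m + s * x.
have F' : F^`()%classic = cst s.
  apply/funext => x; rewrite /F derive1E deriveD// deriveM// !derive_cst.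
  by rewrite derive_id add0r scaler0 addr0 /= -[_ *: _]/(_ * _) mulr1.
under eq_integral do rewrite -EFinM.
rewrite (@increasing_ge0_integration_by_substitutionT R F
  (fun x => G x * normal_pdf m s x)); first last.
- by move=> x; rewrite mulr_ge0// normal_pdf_ge0.
- by move=> x; apply: cvgM; [exact: cG|exact: continuous_normal_pdf].
- apply: (cvg_comp _ (fun x => m + x)); last exact: cvg_addrl.
  by apply: gt0_cvgMry; [exact: s0|exact: cvg_id].
- apply: (cvg_comp _ (fun x => m + x)); last exact: cvg_addrl_Ny.
  by apply: gt0_cvgMrNy; [exact: s0|exact: cvg_id].
- by [].
- by rewrite F'; exact: is_cvg_cst.
- by rewrite F'; exact: is_cvg_cst.
- by rewrite F' => x; exact: cvg_cst.
- by move=> x y xy; rewrite /F ltrD2l ltr_pM2l.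
(* The Jacobian [s] cancels the factor 1 / s hidden in [normal_peak s], and the two exponents
   coincide. *)
apply: eq_integral => x _; rewrite F' !fctE -EFinM -mulrA; congr (_ * _)%:E.
rewrite !normal_pdfE// ?oner_neq0// /normal_peak /normal_fun /F.
have -> : m + s * x - m = s * x by ring.
have -> : - (s * x) ^+ 2 / (s ^+ 2 *+ 2) = - (x - 0) ^+ 2 / (1 ^+ 2 *+ 2).
  by field; rewrite s_neq0.
rewrite -[_ * pi *+ 2]mulrnAr sqrtrM ?sqr_ge0// sqrtr_sqr gtr0_norm//.
rewrite expr1n mul1r; field.
by rewrite s_neq0/= gt_eqF// sqrtr_gt0 mulrn_wgt0// pi_gt0.
Qed.

(** The standard density is even and Lebesgue measure is invariant under negation. *)
Lemma normal_prob_sym (f : R -> \bar R) :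
  measurable_fun [set: R] f -> (forall x, 0 <= f x)%E ->
  (\int[N01]_x f (- x)%R = \int[N01]_x f x)%E.
Proof.
move=> mf f0.
have mfN : measurable_fun [set: R] (fun x : measurableTypeR R => f (- x)).
  by apply: (measurableT_comp mf); exact: oppr_measurable.
rewrite !ge0_integral_normal_prob//.
pose g (x : measurableTypeR R) := (f x * (normal_pdf 0 1 x)%:E)%E.
transitivity (\int[mu]_x (g \o (-%R : _ -> measurableTypeR R)) x)%E.
  apply: eq_integral => x _; rewrite /g /=; congr (_ * _%:E)%E.
  by rewrite !normal_pdfE ?oner_neq0// /normal_fun !subr0 sqrrN.
have mg : measurable_fun [set: R] g.
  apply: emeasurable_funM => //; apply/measurable_EFinP.
  exact: measurable_normal_pdf.
have mN : measurable_fun [set: measurableTypeR R]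
    (-%R : measurableTypeR R -> measurableTypeR R).
  exact: oppr_measurable.
have := @ge0_integral_pushforward _ _ _ _ R _ mN mu setT g measurableT mg.
rewrite preimage_setT => <-.
  by apply: eq_measure_integral => //= A mA _; exact: lebesgue_measureN.
by move=> x _; rewrite mule_ge0// lee_fin normal_pdf_ge0.
Qed.

Lemma normal_moment2_lty : (\int[N01]_x (x ^+ 2)%:E < +oo)%E.
Proof.
have mX : measurable_fun [set: R] (fun x : R => (x ^+ 2)%:E).
  by apply/measurable_EFinP; exact: measurable_funX.
rewrite ge0_integral_normal_prob//; last by move=> x; rewrite lee_fin sqr_ge0.
(* The normal density of deviation 2 serves as majorant. Its exponent exceeds the standard one by
   3/8 x^2, and x^2 <= 8/3 (1 + 3/8 x^2) <= 8/3 exp (3/8 x^2); the quotient of peaks adjusts the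
   normalisations. *)
pose K := 8 / 3 * (@normal_peak R 1 / normal_peak 2).
have neq02 : (2 : R) != 0 by rewrite pnatr_eq0.
apply: (@le_lt_trans _ _ (\int[mu]_x (K%:E * (normal_pdf 0 2 x)%:E)))%E.
  apply: ge0_le_integral => //.
  - by move=> x _; rewrite mule_ge0// lee_fin ?sqr_ge0 ?normal_pdf_ge0.
  - apply: emeasurable_funM => //; apply/measurable_EFinP.
    exact: measurable_normal_pdf.
  - apply: emeasurable_funM => //; apply/measurable_EFinP.
    exact: measurable_normal_pdf.
  - move=> x _; rewrite -!EFinM lee_fin !normal_pdfE ?oner_neq0//.
    have p1 := @normal_peak_gt0 R 1 (oner_neq0 _).
    have p2 := @normal_peak_gt0 R 2 neq02.
    rewrite mulrCA /K.
    rewrite [leRHS](_ : _ = normal_peak 1 * (8 / 3 * normal_fun 0 2 x)); last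
       by field; rewrite gt_eqF.
    rewrite ler_wpM2l ?(ltW p1)// /normal_fun.
    have -> : - (x - 0) ^+ 2 / (2 ^+ 2 *+ 2) =
        - (x - 0) ^+ 2 / (1 ^+ 2 *+ 2) + 3 / 8 * x ^+ 2 :> R by field.
    rewrite expRD mulrCA mulrC ler_wpM2l ?expR_ge0//.
    have := expR_ge1Dx (3 / 8 * x ^+ 2); lra.
rewrite ge0_integralZl//.
- by rewrite integral_normal_pdf mule1 ltry.
- by apply/measurable_EFinP; exact: measurable_normal_pdf.
- by move=> x _; rewrite lee_fin normal_pdf_ge0.
- by rewrite lee_fin !mulr_ge0 ?invr_ge0 ?normal_peak_ge0.
Qed.

(** Otherwise x^2 would vanish almost everywhere and the law would be carried by {0}, which is null
    by absolute continuity. *)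
Lemma normal_moment2_gt0 : (0 < \int[N01]_x (x ^+ 2)%:E)%E.
Proof.
rewrite lt0e; apply/andP; split; last first.
  by apply: integral_ge0 => x _; rewrite lee_fin sqr_ge0.
apply/eqP => x2_eq0.
have mX : measurable_fun [set: R] (fun x : R => (x ^+ 2)%:E).
  by apply/measurable_EFinP; exact: measurable_funX.
have [+ _] := ae_eq_integral_abs (N01 : probability _ _) measurableT mX.
have -> : (\int[N01]_x `|(x ^+ 2)%:E| = 0)%E.
  rewrite -[RHS]x2_eq0; apply: eq_integral => x _.
  by rewrite gee0_abs// lee_fin sqr_ge0.
move=> /(_ erefl) [N [mN N0 subN]].
have N1 : N01 (~` N) = 1%E.
  by have := probability_setC (N01 : probability _ _) mN; rewrite N0 sube0.
have : N01 [set 0] = 0%E.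
  have /null_content_dominatesP := @normal_prob_dominates R 0 1.
  by apply => //; exact: lebesgue_measure_set1.
move=> N00; have : (N01 (~` N) <= N01 [set 0%R])%E.
  apply: le_measure; rewrite ?inE//; first exact: measurableC.
  move=> x /= Nx; have [//|x0] := eqVneq x 0; exfalso; apply: Nx.
  by apply: subN => /= /(_ I) [] /eqP; rewrite sqrf_eq0; exact/negP.
by rewrite N1 N00 lee_fin ler10.
Qed.

Lemma normal_prob_setT_lty : (N01 setT < +oo)%E.
Proof.
apply: le_lt_trans (ltry 1).
exact: (probability_le1 (N01 : probability _ _) measurableT).
Qed.

(** The constant [kappa], that is sqrt (2 / pi). In this quotient form, finiteness and positivity of
    the second moment replace its evaluation. *)
Definition normal_abs_ratio : R :=
  fine (\int[N01]_x `|x|%:E)%E / Num.sqrt (fine (\int[N01]_x (x ^+ 2)%:E)%E).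

Lemma normal_abs_ratio_ge0 : 0 <= normal_abs_ratio.
Proof.
by rewrite /normal_abs_ratio divr_ge0 ?sqrtr_ge0// fine_ge0// integral_ge0.
Qed.

Lemma normal_abs_lty : (\int[N01]_x `|x|%:E < +oo)%E.
Proof.
apply: (@le_lt_trans _ _ (\int[N01]_x (1 + x ^+ 2)%:E))%E.
  apply: ge0_le_integral => //.
  - by apply/measurable_EFinP; exact: normr_measurable.
  - apply/measurable_EFinP; exact: measurable_funD.
  - move=> x _; rewrite lee_fin.
    have := sqr_ge0 (`|x| - 1); have := normr_ge0 x.
    by rewrite -(real_normK (num_real x)); nra.
under eq_integral do rewrite EFinD.
rewrite ge0_integralD//.
- rewrite integral_cst// mul1e lte_add_pinfty//; last exact: normal_moment2_lty.
  exact: normal_prob_setT_lty.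
- by move=> x _; rewrite lee_fin sqr_ge0.
- by apply/measurable_EFinP; exact: measurable_funX.
Qed.

End normal_integral.

(** * Moments of one-dimensional Gaussian variables *)

Section gaussian_law.
Context {R : realType} d (T : measurableType d) (P : probability T R).
Implicit Types f : {RV P >-> R}.
Local Notation N01 := (@normal_prob R 0 1).

Lemma gaussian_law_affine f : gaussian_law (pushforward P f) ->
  exists m s : R, 0 <= s /\ forall G : R -> R, continuous G ->
    (forall x, 0 <= G x) ->
    ('E_P[G \o f] = \int[N01]_x (G (m + s * x))%:E)%E.
Proof.
(* [normal_prob] lives on [measurableTypeR R], which has the same measurable
   sets as [R] but another display. *)
pose GR := measurableTypeR R.
have mf : @measurable_fun _ _ T GR setT f.
  by move=> mT Y; exact: (@measurable_funPT _ _ _ _ f mT Y).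
pose f' : {mfun T >-> GR} :=
  HB.pack (f : T -> GR) (isMeasurableFun.Build _ _ _ _ _ mf).
have EE (G : R -> R) : continuous G -> (forall x, 0 <= G x) ->
    ('E_P[G \o f] = \int[distribution P f']_x (G x)%:E)%E.
  move=> cG G0; rewrite unlock.
  rewrite (@ge0_integral_distribution _ _ _ _ _ P f' (EFin \o G))//.
  by apply: measurableT_comp => //; exact: continuous_measurable_fun cG.
move=> [[m fm]|[m [s [s0 fs]]]].
  exists m, 0; split=> // G cG G0.
  rewrite EE//; transitivity (\int[dirac (m : GR)]_x (G x)%:E)%E.
    by apply: eq_measure_integral => A mA _; exact: fm.
  rewrite integral_dirac//; last first.
    by apply: measurableT_comp => //; exact: continuous_measurable_fun cG.
  rewrite diracT mul1e.
  under [RHS]eq_integral do rewrite mul0r addr0.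
  rewrite integral_cst//.
  by have /= -> := probability_setT (N01 : probability _ _); rewrite mule1.
exists m, s; split; first exact: ltW.
move=> G cG G0; rewrite EE// -normal_prob_affine//.
by apply: eq_measure_integral => A mA _; exact: fs.
Qed.

Lemma Lfun2_sqr_lty f : ('E_P[fun t => (f t ^+ 2)%R] < +oo)%E ->
  (f : T -> R) \in Lfun P 2%:E.
Proof.
move=> f2; rewrite inE; apply/andP; split; rewrite inE//=.
rewrite /finite_norm unlock/= poweR_lty//.
move: f2; rewrite unlock; apply: le_lt_trans.
apply: ge0_le_integral => //.
- apply/measurable_EFinP.
  apply/(@measurableT_comp _ _ _ _ _ _ (fun x : R => x `^ 2)%R) => //.
  exact: measurableT_comp.
- by apply/measurable_EFinP; exact: measurable_funX.
- by move=> x _; rewrite lee_fin powR_mulrn// real_normK// num_real.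
Qed.

Let csqr : continuous (fun x : R => x ^+ 2).
Proof. exact: exprn_continuous. Qed.

Lemma gaussian_Lfun2 f : gaussian_law (pushforward P f) ->
  (f : T -> R) \in Lfun P 2%:E.
Proof.
move=> /gaussian_law_affine[m [s [s0 fE]]]; apply: Lfun2_sqr_lty.
rewrite (fE (fun x => x ^+ 2))//; last by move=> x; exact: sqr_ge0.
(* Coefficients of the bound (m + s x)^2 <= 2 m^2 + 2 s^2 x^2. *)
pose a := 2 * m ^+ 2; pose b := 2 * s ^+ 2.
have a0 : 0 <= a by rewrite mulr_ge0 ?sqr_ge0.
have b0 : 0 <= b by rewrite mulr_ge0 ?sqr_ge0.
apply: (@le_lt_trans _ _ (\int[N01]_x (a + b * x ^+ 2)%:E))%E.
  apply: ge0_le_integral => //.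
  - by move=> x _; rewrite lee_fin sqr_ge0.
  - apply/measurable_EFinP; apply: measurable_funX; exact: measurable_funD.
  - apply/measurable_EFinP; apply: measurable_funD => //.
    exact: measurable_funM.
  - move=> x _; rewrite lee_fin.
    have := sqr_ge0 (m - s * x); rewrite /a /b; nra.
under eq_integral do rewrite EFinD.
rewrite ge0_integralD//.
- rewrite integral_cst// lte_add_pinfty//.
    rewrite lte_mul_pinfty//.
    exact: normal_prob_setT_lty.
  under eq_integral do rewrite EFinM.
  rewrite ge0_integralZl//.
  - by rewrite lte_mul_pinfty//; exact: normal_moment2_lty.
  - by apply/measurable_EFinP; exact: measurable_funX.
  - by move=> x _; rewrite lee_fin sqr_ge0.
- by move=> x _; rewrite lee_fin mulr_ge0 ?sqr_ge0.
- by apply/measurable_EFinP; exact: measurable_funM.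
Qed.

Lemma RV_Lfun12 f : (f : T -> R) \in Lfun P 2%:E -> (f : T -> R) \in Lfun P 1.
Proof. by move=> f2; rewrite Lfun_subset12 ?fin_num_measure. Qed.

(** In law [f] is m + s g. Once m = 0 is known, E|f| and sqrt (E f^2) are both proportional to s,
    and their ratio is that of g. *)
Lemma gaussian_mean_abs f : gaussian_law (pushforward P f) -> ('E_P[f] = 0)%E ->
  ('E_P[fun t => `|f t|%R] =
   (normal_abs_ratio R * Num.sqrt (fine 'E_P[fun t => (f t ^+ 2)%R]))%:E)%E.
Proof.
move=> gf Ef0.
have f1 : (f : T -> R) \in Lfun P 1 by exact/RV_Lfun12/gaussian_Lfun2.
move: gf => /gaussian_law_affine[m [s [s0 fE]]].
have cmax (h : R -> R) : continuous h -> continuous (fun x => Num.max (h x) 0).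
  by move=> ch x; apply: continuous_max; [exact: ch|exact: cvg_cst].
have cB : continuous (fun x : R => x - m).
  by move=> x; apply: (@cvgB _ R^o); [exact: cvg_id|exact: cvg_cst].
have cB' : continuous (fun x : R => m - x).
  by move=> x; apply: (@cvgB _ R^o); [exact: cvg_cst|exact: cvg_id].
have max0 (x : R) : 0 <= Num.max x 0 by rewrite le_max lexx orbT.
have EP := fE _ (cmax _ cB) (fun x => max0 _).
have EN := fE _ (cmax _ cB') (fun x => max0 _).
(* The affine representation covers nonnegative functions only, so the mean of f - m is reached
   through its positive and negative parts. These have equal means by the symmetry of the standard
   normal law. *)
have EPN : ('E_P[(fun x => Num.max (x - m)%R 0%R) \o f] =
            'E_P[(fun x => Num.max (m - x)%R 0%R) \o f])%E.
  rewrite EP EN.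
  pose h x := (Num.max (s * x) 0)%:E.
  have ch : continuous (fun x : R => s * x).
    by move=> x; apply: cvgM; [exact: cvg_cst|exact: cvg_id].
  have mh : measurable_fun [set: R] h.
    apply: measurableT_comp => //.
    exact: continuous_measurable_fun (cmax _ ch).
  transitivity (\int[N01]_x h x)%E.
    by apply: eq_integral => x _; rewrite /h; congr (Num.max _ _)%:E; ring.
  rewrite -normal_prob_sym//; last by move=> x; rewrite lee_fin.
  by apply: eq_integral => x _; rewrite /h; congr (Num.max _ _)%:E; ring.
have fm1 : (f \- cst m : T -> R) \in Lfun P 1.
  by rewrite rpredB//= Lfun_cst.
have m0 : m = 0.
  have : ('E_P[(f \- cst m)%R] = 0)%E.
    rewrite unlock integralE.
    (* Zero is written as the mean of the positive part minus itself, which is legitimate because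
       that mean is finite. *)
    rewrite -[RHS](subee (x :=
      (\int[P]_x (EFin \o (f \- cst m)%R)^\+ x)%E)); last first.
      exact/integrable_pos_fin_num/Lfun1_integrable.
    congr (_ - _)%E; apply/esym; move: EPN; rewrite unlock => EPN.
    transitivity (\int[P]_w (Num.max (f w - m) 0)%:E)%E.
      by apply: eq_integral => x _; rewrite funeposE/= EFin_max.
    rewrite EPN; apply: eq_integral => x _.
    by rewrite funenegE/= EFin_max opprB.
  rewrite expectationB//= ?Lfun_cst// Ef0 expectation_cst sub0e => /eqP.
  by rewrite eqe_oppLR oppe0 eqe => /eqP.
rewrite (fE (fun x => `|x|))//; last exact: norm_continuous.
rewrite (fE (fun x => x ^+ 2))//; last by move=> x; exact: sqr_ge0.
have -> : (\int[N01]_x `|m + s * x|%:E = s%:E * \int[N01]_x `|x|%:E)%E.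
  rewrite -ge0_integralZl//; last first.
    by apply/measurable_EFinP; exact: normr_measurable.
  by apply: eq_integral => x _; rewrite m0 add0r normrM ger0_norm.
have -> : (\int[N01]_x ((m + s * x) ^+ 2)%:E =
           (s ^+ 2)%:E * \int[N01]_x (x ^+ 2)%:E)%E.
  rewrite -ge0_integralZl//.
  - by apply: eq_integral => x _; rewrite m0 add0r exprMn.
  - by apply/measurable_EFinP; exact: measurable_funX.
  - by move=> x _; rewrite lee_fin sqr_ge0.
  - by rewrite lee_fin sqr_ge0.
have M2 := normal_moment2_gt0 R; have M2y := normal_moment2_lty R.
have M2f : (\int[N01]_x (x ^+ 2)%:E)%E \is a fin_num.
  by rewrite ge0_fin_numE// ltW.
have M1f : (\int[N01]_x `|x|%:E)%E \is a fin_num.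
  by rewrite ge0_fin_numE ?normal_abs_lty//; exact: integral_ge0.
(* Since s >= 0, the root of s^2 is s; the second moment then cancels because it is positive. *)
rewrite fineM// sqrtrM ?sqr_ge0//= sqrtr_sqr ger0_norm// /normal_abs_ratio.
rewrite -[X in (_ * X)%E]fineK// -EFinM; congr (_%:E).
by field; rewrite gt_eqF// sqrtr_gt0 fine_gt0// M2.
Qed.

End gaussian_law.

(** * Averages over all choices of signs *)

Section random_signs.
Variables (R : realFieldType) (n : nat).
Implicit Types (x : 'I_n -> R) (i j : 'I_n).
Local Notation signs := {ffun 'I_n -> bool}.

(** The average is kept as a sum over [signs], whence the factor 2^n. For [e] and its flip at all
    indices but [i], the signed sums add up to 2 x_i or - 2 x_i, so their absolute values add up to
    at least 2 |x_i|. *)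
Lemma sum_signs_le x i :
  2 ^+ n * `|x i| <= \sum_(e : signs) `|\sum_j (-1) ^+ (e j) * x j|.
Proof.
pose S (e : signs) := \sum_j (-1) ^+ (e j) * x j.
pose flip (e : signs) : signs := [ffun j => e j (+) (j != i)].
have flipK : involutive flip.
  by move=> e; apply/ffunP => j; rewrite !ffunE addbK.
have flipS e : S e + S (flip e) = 2 * ((-1) ^+ (e i) * x i).
  rewrite /S -big_split /= (bigD1 i)//= big1 ?addr0 => [|j ji].
    by rewrite ffunE eqxx addbF; ring.
  by rewrite ffunE ji addbT signrN; ring.
rewrite -(ler_pM2l (ltr0n R 2)) [leRHS]mulr_natl mulr2n.
rewrite [X in _ <= _ + X](reindex_inj (inv_inj flipK)) -big_split /=.
rewrite mulrCA (_ : 2 ^+ n * _ = \sum_(e : signs) 2 * `|x i|); last first.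
  by rewrite sumr_const card_ffun card_bool card_ord -[RHS]mulr_natl natrX.
apply: ler_sum => e _; rewrite (le_trans _ (ler_normD _ _))//.
by rewrite -!/(S _) flipS !normrM normr_sign mul1r normr_nat.
Qed.

(** Orthogonality of the signs: for i <> j, flipping the sign at [i] alone negates every term, so
    the sum equals its own opposite. *)
Lemma sum_signs_mul i j :
  \sum_(e : signs) (-1) ^+ (e i) * (-1) ^+ (e j) = 2 ^+ n *+ (i == j) :> R.
Proof.
have [->|ij] := eqVneq i j.
  under eq_bigr do rewrite -signr_addb addbb.
  by rewrite sumr_const card_ffun card_bool card_ord natrX.
pose flip (e : signs) : signs := [ffun k => e k (+) (k == i)].
have flipK : involutive flip.
  by move=> e; apply/ffunP => k; rewrite !ffunE addbK.
set s := LHS; suff : s = - s by rewrite mulr0n; lra.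
rewrite {1}/s (reindex_inj (inv_inj flipK)) -sumrN; apply: eq_bigr => e _.
by rewrite !ffunE eqxx eq_sym (negbTE ij) addbT addbF signrN mulNr.
Qed.

End random_signs.

Lemma sum_delta_mul (R : pzSemiRingType) (I : finType) (x : I -> R) i :
  \sum_j (j == i)%:R * x j = x i.
Proof.
rewrite (bigD1 i)//= eqxx mul1r big1 ?addr0// => j /negbTE ->.
by rewrite mul0r.
Qed.

(** * Linear combinations of the coordinates of a Gaussian vector *)

Section linear_combination.
Context (R : realType) (n : nat) d (T : measurableType d) (P : probability T R).
Variable X : 'I_n -> {RV P >-> R}.
Implicit Type a : 'I_n -> R.

Definition lin_comb a t := \sum_i a i * X i t.
Local Notation lin := lin_comb.

Lemma measurable_lin a : measurable_fun [set: T] (lin a).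
Proof.
by apply: measurable_sum => i; apply: measurable_funM.
Qed.

Lemma measurable_sup_norm : measurable_fun [set: T] (sup_norm X).
Proof.
rewrite /sup_norm; elim: (index_enum _) => [|i s IHs].
  by under eq_fun do rewrite big_nil; exact: measurable_cst.
under eq_fun do rewrite big_cons.
by apply: measurable_maxr => //; exact: measurableT_comp.
Qed.

Lemma expectation_sum_ord (I : finType) (g : I -> T -> R) :
  (forall i, g i \in Lfun P 1) ->
  ('E_P[fun t => (\sum_i g i t)%R] = \sum_i 'E_P[g i])%E.
Proof.
move=> g1.
have := @expectation_sum _ _ _ P [seq g i | i <- index_enum I].
rewrite !big_map => <-; last by move=> _ /mapP[i _ ->].
by congr expectation; apply/funext => t; rewrite fct_sumE.
Qed.

Hypothesis gX : gaussian_vector X.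

Lemma gaussian_coord_Lfun2 i : (X i : T -> R) \in Lfun P 2%:E.
Proof.
apply: gaussian_Lfun2; have := gX (fun j => (j == i)%:R).
rewrite (_ : (fun t => _) = X i)//; apply/funext => t.
exact: sum_delta_mul.
Qed.

Hypothesis cX : centred X.

Lemma cov_mxE i j : cov_mx X i j = fine 'E_P[(X i \* X j)%R].
Proof.
rewrite mxE unlock !cX /=; congr (fine 'E_P[_]).
by apply/funext => t; rewrite !fctE /= !subr0.
Qed.

(** The coordinates are square integrable, so the [fine] in [cov_mx] discards no infinite value. *)
Lemma cov_mx_fin i j : ('E_P[(X i \* X j)%R] = (cov_mx X i j)%:E)%E.
Proof.
rewrite cov_mxE fineK// expectation_fin_num//.
by apply: Lfun2_mul_Lfun1; exact: gaussian_coord_Lfun2.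
Qed.

Lemma expectation_lin a : ('E_P[lin a] = 0)%E.
Proof.
have X1 i : (X i : T -> R) \in Lfun P 1.
  exact/RV_Lfun12/gaussian_coord_Lfun2.
have -> : lin a = (fun t => \sum_i (a i \o* X i) t).
  by apply/funext => t; apply: eq_bigr => i _; rewrite mulrC.
rewrite expectation_sum_ord => [|i]; last by rewrite Lfun_scale.
rewrite big1// => i _.
by rewrite expectationZl ?cX ?mule0.
Qed.

Lemma expectation_lin_sqr a :
  ('E_P[fun t => (lin a t ^+ 2)%R] =
   (\sum_i \sum_j a i * a j * cov_mx X i j)%:E)%E.
Proof.
pose c (p : 'I_n * 'I_n) := a p.1 * a p.2.
have XX1 (p : 'I_n * 'I_n) : (X p.1 \* X p.2)%R \in Lfun P 1.
  by apply: Lfun2_mul_Lfun1; exact: gaussian_coord_Lfun2.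
have -> : (fun t => lin a t ^+ 2) =
          (fun t => \sum_p (c p \o* (X p.1 \* X p.2)%R) t).
  apply/funext => t; rewrite expr2 /lin_comb big_distrlr/= pair_bigA/=.
  by apply: eq_bigr => p _; rewrite /c; ring.
rewrite expectation_sum_ord => [|p]; last by rewrite Lfun_scale.
rewrite pair_bigA/= -sumEFin; apply: eq_bigr => p _.
by rewrite expectationZl; [rewrite cov_mx_fin -EFinM|exact: XX1].
Qed.

(** A linear combination is itself centred Gaussian, and its variance is the quadratic form of the
    covariance matrix at [a]. *)
Lemma expectation_norm_lin a :
  ('E_P[fun t => `|lin a t|%R] = (normal_abs_ratio R *
     Num.sqrt (\sum_i \sum_j a i * a j * cov_mx X i j))%:E)%E.
Proof.
pose f : {mfun T >-> R} :=
  HB.pack (lin a) (isMeasurableFun.Build _ _ _ _ _ (measurable_lin a)).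
have := @gaussian_mean_abs _ _ _ P f (gX a) (expectation_lin a).
by rewrite expectation_lin_sqr.
Qed.

End linear_combination.

(** * Upper and lower bounds for the mean of the maximum norm *)

Section mean_sup_norm.
Context (R : realType) (n : nat) d (T : measurableType d) (P : probability T R).
Variable X : 'I_n -> {RV P >-> R}.
Local Notation kappa := (normal_abs_ratio R).

Lemma sup_norm_ge0 t : 0 <= sup_norm X t.
Proof. exact: bigmax_ge_id. Qed.

Lemma le_sup_norm i t : `|X i t| <= sup_norm X t.
Proof. exact: le_bigmax. Qed.

Lemma measurable_norm_lin a :
  measurable_fun [set: T] (fun t => `|lin_comb X a t|).
Proof. by apply: measurableT_comp => //; exact: measurable_lin. Qed.

Lemma Lfun1_fin_abs (f : T -> R) (r : R) : measurable_fun [set: T] f ->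
  ('E_P[fun t => `|f t|%R] = r%:E)%E -> (fun t => `|f t|) \in Lfun P 1.
Proof.
move=> mf fr; apply/Lfun1_integrable/integrableP; split.
  by apply/measurable_EFinP; exact: measurableT_comp.
rewrite (_ : (\int[P]_x _)%E = r%:E) ?ltry//.
by rewrite -fr unlock; apply: eq_integral => t _; rewrite /= normr_id.
Qed.

Hypotheses (gX : gaussian_vector X) (cX : centred X).

Lemma expectation_norm_coord i :
  ('E_P[fun t => `|X i t|%R] = (kappa * Num.sqrt (cov_mx X i i))%:E)%E.
Proof.
have := expectation_norm_lin gX cX (fun j => (j == i)%:R).
rewrite (_ : (fun t => _) = (fun t => `|X i t|)); last first.
  by apply/funext => t; rewrite /lin_comb sum_delta_mul.
rewrite (bigD1 i)//= [X in _ + X]big1 ?addr0 => [|j /negbTE ji]; last first.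
  by rewrite big1// => k _; rewrite ji !mul0r.
rewrite (bigD1 i)//= eqxx !mul1r big1 ?addr0// => j /negbTE ->.
by rewrite mulr0 mul0r.
Qed.

Lemma coord_le_mean_sup_norm i :
  ((kappa * Num.sqrt (cov_mx X i i))%:E <= 'E_P[sup_norm X])%E.
Proof.
rewrite -expectation_norm_coord; apply: expectation_le => //.
- exact: measurableT_comp.
- exact: measurable_sup_norm.
- exact: sup_norm_ge0.
- by apply/nearW => t; exact: le_sup_norm.
Qed.

Lemma mean_sup_norm_le : \tr (cov_mx X) = 1 -> ('E_P[sup_norm X] <= kappa%:E)%E.
Proof.
move=> tr1.
pose a (e : {ffun 'I_n -> bool}) i : R := (-1) ^+ (e i).
pose g e t := `|lin_comb X (a e) t|.
pose v e := \sum_i \sum_j a e i * a e j * cov_mx X i j.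
have sum_g_ge0 t : 0 <= \sum_e g e t.
  by apply: sumr_ge0 => e _; rewrite normr_ge0.
have gE e : ('E_P[g e] = (kappa * Num.sqrt (v e))%:E)%E.
  exact: expectation_norm_lin.
have g1 e : g e \in Lfun P 1.
  by apply: Lfun1_fin_abs (gE e); exact: measurable_lin.
have v_ge0 e : 0 <= v e.
  rewrite -lee_fin -expectation_lin_sqr//; apply: expectation_ge0 => t.
  exact: sqr_ge0.
have two_gt0 : 0 < 2 ^+ n :> R by rewrite exprn_gt0.
(* Orthogonality of the signs kills the off-diagonal covariances and leaves 2^n times the trace. *)
have sum_v : \sum_e v e = 2 ^+ n.
  transitivity (2 ^+ n * \tr (cov_mx X)); last by rewrite tr1 mulr1.
  rewrite exchange_big/= /mxtrace mulr_sumr; apply: eq_bigr => i _.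
  rewrite exchange_big/=; under eq_bigr do rewrite -mulr_suml sum_signs_mul.
  rewrite (bigD1 i)//= eqxx big1 ?addr0// => j ji.
  by rewrite eq_sym (negbTE ji) mul0r.
apply: (@le_trans _ _ 'E_P[(2 ^+ n)^-1 \o* (fun t => (\sum_e g e t)%R)])%E.
  apply: expectation_le.
  - exact: measurable_sup_norm.
  - apply: measurable_funM => //; apply: measurable_sum => e.
    exact: measurable_norm_lin.
  - exact: sup_norm_ge0.
  - by move=> t; apply: mulr_ge0; [exact: sum_g_ge0|rewrite invr_ge0 ltW].
  - apply/nearW => t /=; rewrite ler_pdivlMr//.
    rewrite /sup_norm.
    apply: (big_ind (fun y => y * 2 ^+ n <= _)) => [|x y hx hy|i _].
    + by rewrite mul0r sum_g_ge0.
    + by rewrite maxEge; case: ifP.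
    + rewrite mulrC; exact: sum_signs_le.
rewrite expectationZl; last first.
  rewrite (_ : (fun t => _) = \sum_e g e) ?rpred_sum//.
  by apply/funext => t; rewrite fct_sumE.
rewrite expectation_sum_ord// (eq_bigr _ (fun e _ => gE e)) sumEFin -EFinM.
rewrite lee_fin mulrC ler_pdivrMr// -mulr_sumr.
rewrite ler_wpM2l ?normal_abs_ratio_ge0//.
(* The square root lies below its tangent at 1, and 1 is the average of the [v e]. *)
apply: (@le_trans _ _ (\sum_e (v e + 1) / 2)).
  apply: ler_sum => e _; rewrite -{2}(@sqr_sqrtr _ (v e)) ?v_ge0//.
  have := sqr_ge0 (Num.sqrt (v e) - 1); nra.
rewrite -mulr_suml big_split/= sum_v sumr_const card_ffun card_bool card_ord.
by rewrite natrX; lra.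
Qed.

(** It suffices to find two combinations, each of variance 1, whose absolute values add up to at
    most twice the maximum norm: each has mean absolute value [kappa]. *)
Lemma mean_sup_norm_ge : \tr (cov_mx X) = 1 -> is_diag_mx (cov_mx X) ->
  (#|[pred ij : 'I_n * 'I_n | cov_mx X ij.1 ij.2 != 0%R]| <= 2)%N ->
  (kappa%:E <= 'E_P[sup_norm X])%E.
Proof.
move=> tr1 /is_diag_mxP diag card2.
pose C i := cov_mx X i i.
(* For a diagonal covariance the variance is the sum of a_i^2 C_i, which is the trace if a_i^2 = 1
   wherever C_i is non-zero. *)
have key (a : 'I_n -> R) : (forall i, C i != 0 -> a i ^+ 2 = 1) ->
    ('E_P[fun t => `|lin_comb X a t|%R] = kappa%:E)%E.
  move=> a1; rewrite expectation_norm_lin//; congr (_%:E).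
  rewrite (_ : \sum_i _ = 1) ?sqrtr1 ?mulr1// -tr1; apply: eq_bigr => i _.
  rewrite (bigD1 i)//= big1 ?addr0 => [|j ji]; last first.
    by rewrite diag ?mulr0// eq_sym.
  have [->|C0] := eqVneq (cov_mx X i i) 0; first by rewrite mulr0.
  by rewrite -expr2 a1// mul1r.
suff [a [b [aC bC ab]]] : exists a b : 'I_n -> R,
    [/\ forall i, C i != 0 -> a i ^+ 2 = 1, forall i, C i != 0 -> b i ^+ 2 = 1 &
        forall t, `|lin_comb X a t| + `|lin_comb X b t| <= 2 * sup_norm X t].
  have Ea := key _ aC; have Eb := key _ bC.
  have a1 := Lfun1_fin_abs (measurable_lin X a) Ea.
  have b1 := Lfun1_fin_abs (measurable_lin X b) Eb.
  have <- : ('E_P[2^-1 \o* ((fun t => `|lin_comb X a t|) \+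
      (fun t => `|lin_comb X b t|))%R] = kappa%:E)%E.
    rewrite expectationZl ?rpredD// expectationD// Ea Eb -EFinD -EFinM.
    by congr (_%:E); lra.
  apply: expectation_le.
  - apply: measurable_funM => //.
    by apply: measurable_funD; exact: measurable_norm_lin.
  - exact: measurable_sup_norm.
  - by move=> t /=; rewrite mulr_ge0 ?addr_ge0.
  - exact: sup_norm_ge0.
  - by apply/nearW => t /=; have := ab t; lra.
pose S := [set i | C i != 0]%SET.
(* The hypothesis counts matrix entries; the injection of [i] to (i, i) turns it into a bound on the
   support of the diagonal. *)
have cardS : (#|S| <= 2)%N.
  rewrite (leq_trans _ card2)// -(card_imset S (f := fun i => (i, i))).
    apply: subset_leq_card; apply/fintype.subsetP => _ /imsetP[i + ->].
    by rewrite !inE.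
  by move=> i j [].
have [S0|[i Si]] := set_0Vmem S.
  move: tr1 => /eqP; rewrite /mxtrace big1 ?(eq_sym 0) ?oner_eq0// => i _.
  apply/eqP; apply: contraT => Ci.
  by have : i \in S; [rewrite inE|rewrite S0 finset.in_set0].
have [S1|[j /setD1P[ji Sj]]] := set_0Vmem (S :\ i).
  have iP k : C k != 0 -> k = i.
    move=> Ck; apply/eqP; apply: contraT => ki.
    by have : k \in S :\ i; [rewrite !inE ki|rewrite S1 finset.in_set0].
  (* With a single non-zero variance, both combinations are X_i. *)
  exists (fun k => (k == i)%:R), (fun k => (k == i)%:R).
  split=> [k /iP ->|k /iP ->|t]; rewrite ?eqxx ?expr1n//.
  by rewrite /lin_comb sum_delta_mul; have := le_sup_norm i t; lra.
have SE : S = [set i; j]%SET.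
  apply/esym/eqP; rewrite eqEcard cards2 eq_sym ji cardS andbT.
  apply/fintype.subsetP => k; rewrite !inE => /orP[]/eqP ->.
    by move: Si; rewrite inE.
  by move: Sj; rewrite inE.
have ijP k : C k != 0 -> k = i \/ k = j.
  move=> Ck; have : k \in S by rewrite inE.
  by rewrite SE !inE => /orP[]/eqP; [left|right].
(* With two, the combinations are X_i + X_j and X_i - X_j, and |x + y| + |x - y| = 2 max (|x|,
   |y|). *)
exists (fun k => (k == i)%:R + (k == j)%:R),
       (fun k => (k == i)%:R - (k == j)%:R).
split=> [k /ijP[]->|k /ijP[]->|t].
- by rewrite eqxx eq_sym (negbTE ji) addr0 expr1n.
- by rewrite eqxx (negbTE ji) add0r expr1n.
- by rewrite eqxx eq_sym (negbTE ji) subr0 expr1n.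
- by rewrite eqxx (negbTE ji) sub0r sqrrN expr1n.
rewrite /lin_comb.
under eq_bigr do rewrite mulrDl.
under [X in _ + `|X|]eq_bigr do rewrite mulrBl.
rewrite big_split sumrB/= !sum_delta_mul.
have := le_sup_norm i t; have := le_sup_norm j t.
set x := X i t; set y := X j t; rewrite !ler_norml => /andP[? ?] /andP[? ?].
have [xy|xy] := leP 0 (x + y); have [yx|yx] := leP 0 (x - y);
  rewrite ?(ger0_norm xy) ?(ltr0_norm xy) ?(ger0_norm yx) ?(ltr0_norm yx); lra.
Qed.

End mean_sup_norm.

(** * Comparison of the extremal vectors with arbitrary competitors *)

Theorem theorem2 (R : realType) (n : nat) (n_ge1 : (1 <= n)%N)
    (d : measure_display) (T : measurableType d) (P : probability T R)
    (X : 'I_n -> {RV P >-> R}) (gX : normalized_gaussian X) :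
  (is_diag_mx (cov_mx X) ->
   (#|[pred ij : 'I_n * 'I_n | cov_mx X ij.1 ij.2 != 0%R]| <= 2)%N ->
   maximizes_mean_sup_norm X) /\
  ((forall i j : 'I_n, {ae P, forall t, `|X i t| = `|X j t|}) ->
   minimizes_mean_sup_norm X).
Proof.
case: gX => gX cX trX; split=> [diagX card2|absX] d' T' P' Y [gY cY trY].
  (* The constant [kappa] separates the two means: it bounds that of [Y] from above and that of [X]
     from below. *)
  apply: le_trans (mean_sup_norm_le gY cY trY) _.
  exact: mean_sup_norm_ge.
pose i0 := Ordinal n_ge1.
have n_neq0 : n%:R != 0 :> R by rewrite pnatr_eq0 -lt0n.
(* Almost surely equal absolute values have equal second moments; the trace then makes every
   variance 1 / n. *)
have covX i : cov_mx X i i = cov_mx X i0 i0.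
  rewrite !cov_mxE//; congr fine; rewrite unlock; apply: ae_eq_integral => //.
  - by apply/measurable_EFinP; exact: measurable_funM.
  - by apply/measurable_EFinP; exact: measurable_funM.
  - apply: filterS (absX i i0) => t Xt _ /=; congr (_%:E).
    by rewrite -!expr2 -real_normK ?num_real// Xt real_normK// num_real.
have covX0 : cov_mx X i0 i0 = n%:R^-1.
  move: trX; rewrite /mxtrace (eq_bigr _ (fun i _ => covX i)) sumr_const.
  by rewrite card_ord => nC; apply: (mulfI n_neq0); rewrite mulr_natl nC divff.
(* If every variance of [Y] were below 1 / n, the trace would be below 1; the index [i0] makes the
   inequality of sums strict. *)
have [j Yj] : exists j, n%:R^-1 <= cov_mx Y j j.
  apply/existsP; apply: contraT; rewrite negb_exists => /forallP Yn.
  have : \tr (cov_mx Y) < \sum_(i < n) n%:R^-1.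
    rewrite /mxtrace; apply: ltr_sum => [|j _]; last by rewrite ltNge Yn.
    by apply/hasP; exists i0; rewrite ?mem_index_enum.
  by rewrite trY sumr_const card_ord -[X in _ < X]mulr_natl divff// ltxx.
apply: le_trans (coord_le_mean_sup_norm gY cY j).
apply: (@le_trans _ _ 'E_P[fun t => `|X i0 t|%R])%E.
  apply: expectation_le.
  - exact: measurable_sup_norm.
  - exact: measurableT_comp.
  - exact: sup_norm_ge0.
  - by [].
  (* Finitely many null sets are discarded together; off them the maximum is at most |X_i0|. *)
  - apply: filterS (filter_forall _ (fun i => absX i i0)) => t Xt.
    by rewrite /sup_norm; apply: bigmax_le => // i _; rewrite Xt.
rewrite expectation_norm_coord// covX0 lee_fin.
by rewrite ler_wpM2l ?normal_abs_ratio_ge0// ler_wsqrtr.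
Qed.
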